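(* Let $q\ge1$, let $\{a_n\}_{n\ge1}$, $\{b_n\}_{n\ge1}$ be real $q$-periodic sequences with $a_n>0$, and let $\bigcup_k[c_k,d_k]$ be the decomposition into spectral bands of the absolutely continuous (equivalently, essential) spectrum of the Jacobi operator $J_0$ with coefficients $a_n,b_n$. Let $\{a'_n\}_{n\ge1}$, $\{b'_n\}_{n\ge1}$ be real sequences with $a_n+a'_n>0$ for all $n$, and suppose $a'_n=\frac{o(1)}{1+n}$ and $b'_n=\frac{o(1)}{1+n}$ as $n\to\infty$. Let $J$ be the perturbed Jacobi operator $$(Ju)(n)=(a_{n+1}+a'_{n+1})u(n+1)+(a_n+a'_n)u(n-1)+(b_{n+1}+b'_{n+1})u(n).$$ Then for any $E\in\bigcup_k(c_k,d_k)$ there is no non-trivial $\ell^2(\mathbb{Z}_{\ge0})$ solution $u=(u(n))_{n\ge0}$ of $Ju=Eu$.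
   Context: The unperturbed operator is $(J_0u)(n)=a_{n+1}u(n+1)+a_nu(n-1)+b_{n+1}u(n)$. A solution of $Ju=Eu$ on $\mathbb{Z}_{\ge0}$ is a sequence $(u(n))_{n\ge0}$ satisfying $(Ju)(n)=Eu(n)$ for all $n\ge1$, so that it is determined by $(u(0),u(1))$. We have $\sigma_{\rm ac}(J_0)=\sigma_{\rm ess}(J_0)=\bigcup_k[c_k,d_k]$. For $E\in(c_k,d_k)$ there is a Floquet solution $\varphi(n)=p(n)e^{i\frac{k(E)}{q}n}$ of $J_0\varphi=E\varphi$, where $p$ is $q$-periodic and $k(E)\in(0,\pi)$ is the quasimomentum, so $\varphi(n+q)=e^{ik(E)}\varphi(n)$. The open intervals $(c_k,d_k)$ are the connected components of the set of real $E$ for which the discriminant (trace of the transfer matrix over one period) has absolute value less than $2$. *)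

(* Defs.v *)
From HB Require Import structures.
From mathcomp Require Import all_boot all_order all_algebra.
From mathcomp Require Import complex.
From mathcomp Require Import all_classical all_reals all_analysis.
Import Order.TTheory GRing.Theory Num.Theory.
Import numFieldNormedType.Exports.

Set Implicit Arguments.
Unset Strict Implicit.
Unset Printing Implicit Defensive.

Local Open Scope classical_set_scope.
Local Open Scope ring_scope.
Local Open Scope complex_scope.

(* The coefficient sequences are indexed by n >= 1; they are represented as
   functions on nat, and no definition below reads them at index 0 except
   [jacobi] in row 0. *)

Section JacobiOperators.
Variable R : realType.
Implicit Types (a b : nat -> R) (u : nat -> R[i]) (E : R) (n q : nat).

(* Row 0 is a dummy value (0.-1 = 0): solutions only involve rows n >= 1. *)
Definition jacobi a b u : nat -> R[i] := fun n =>
  (a n.+1)%:C * u n.+1 + (a n)%:C * u n.-1 + (b n.+1)%:C * u n.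

Definition jacobi_solution a b E u :=
  forall n, (1 <= n)%N -> jacobi a b u n = E%:C * u n.

Definition square_summable u :=
  cvgn (series (fun n => ComplexField.Normc.normc (u n) ^+ 2)).

(* Maps (u(n), u(n-1)) to (u(n+1), u(n)) for solutions, n >= 1. *)
Definition transfer_step a b E n : 'M[R]_2 :=
  \matrix_(i < 2, j < 2)
    if i == 0 then
      if j == 0 then (E - b n.+1) / a n.+1 else - (a n / a n.+1)
    else
      if j == 0 then 1 else 0.

(* T_n *m ... *m T_1 *)
Fixpoint transfer a b E n : 'M[R]_2 :=
  if n is m.+1 then transfer_step a b E m.+1 *m transfer a b E m else 1%:M.

Definition discriminant a b q E : R := \tr (transfer a b E q).

(* The bands of the q-periodic operator, given by their pairs of endpoints
   (c, d): the intervals ]c, d[ are the connected components of the set where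
   the discriminant lies in ]-2, 2[.  In particular two bands may touch (closed
   gap), and the common endpoint then belongs to neither open band. *)
Definition spectral_bands a b q : set (R * R) :=
  let S := [set E : R | `|discriminant a b q E| < 2] in
  [set cd | exists2 E, S E & connected_component S E = `]cd.1, cd.2[%classic].

End JacobiOperators.

(* Main.v *)
Require Import Defs.
From HB Require Import structures.
From mathcomp Require Import all_boot all_order all_algebra.
From mathcomp Require Import complex.
From mathcomp Require Import all_classical all_reals all_analysis.
From mathcomp Require Import ring lra.
Import Order.TTheory GRing.Theory Num.Theory.
Import numFieldNormedType.Exports.

(* Let P n be the transfer matrices of the periodic operator at an energy E of
   the open band.  The monodromy matrix has determinant 1 and |trace| < 2, so
   Cayley-Hamilton gives along each residue class mod q the recurrence
   s (k+2) = t * s (k+1) - s k with |t| < 2; its conserved quadratic form is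
   definite, hence all P n are bounded.  The two Wronskians of a real perturbed
   solution u with the unperturbed basis solutions then have o(1/n) relative
   increments, so the sum g n of their absolute values satisfies
   n * g n ^ 2 >= c > 0.  As g n ^ 2 is at most a multiple of
   u n ^ 2 + u (n+1) ^ 2, the harmonic series rules out square summability.
   A complex solution is handled through its real and imaginary parts. *)

Set Implicit Arguments.
Unset Strict Implicit.
Unset Printing Implicit Defensive.

Local Open Scope classical_set_scope.
Local Open Scope ring_scope.

(** * Boundedness of elliptic second-order recurrences *)

Lemma elliptic_recurrence_bounded (R : realFieldType) (t : R) (s : nat -> R) :
  `|t| < 2 -> (forall k, s k.+2 = t * s k.+1 - s k) ->
  exists B, forall k, `|s k| <= B.
Proof.
rewrite ltr_norml => /andP[t1 t2] sE.
pose F k := s k.+1 ^+ 2 - t * s k.+1 * s k + s k ^+ 2.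
have FE k : F k = F 0%N by elim: k => // k <-; rewrite /F sE; ring.
have F0 k : (4 - t ^+ 2) * s k ^+ 2 <= 4 * F 0%N.
  rewrite -(FE k) /F -subr_ge0.
  have -> : 4 * (s k.+1 ^+ 2 - t * s k.+1 * s k + s k ^+ 2)
      - (4 - t ^+ 2) * s k ^+ 2 = (2 * s k.+1 - t * s k) ^+ 2 by ring.
  exact: sqr_ge0.
have t4 : 0 < 4 - t ^+ 2.
  have -> : 4 - t ^+ 2 = (2 - t) * (2 + t) by ring.
  by apply: mulr_gt0; lra.
(* The bound on [s k ^+ 2] passes to [s k] through [2 * |s k| <= 1 + s k ^+ 2], without square
   roots. *)
exists (1 + 4 * F 0%N / (4 - t ^+ 2)) => k.
have sF : s k ^+ 2 <= 4 * F 0%N / (4 - t ^+ 2) by rewrite ler_pdivlMr// mulrC.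
have := sqr_ge0 (`|s k| - 1); rewrite -real_normK ?num_real// in sF *.
nra.
Qed.

Lemma bounded_residues (R : realFieldType) (q : nat) (f : nat -> R) :
  (0 < q)%N ->
  (forall r, exists B, forall k, `|f (r + k * q)%N| <= B) ->
  exists B, forall n, `|f n| <= B.
Proof.
move=> q0 /choice[B fB]; exists (\sum_(r < q) B r) => n.
have B0 r : 0 <= B r by apply: le_trans (fB r 0%N); exact: normr_ge0.
have nq : (n %% q < q)%N by rewrite ltn_mod.
rewrite (bigD1 (Ordinal nq))//= [n in f n](divn_eq n q) addnC.
apply: (le_trans (fB _ _)); rewrite lerDl; apply: sumr_ge0 => i _; exact: B0.
Qed.

(** * Transfer matrices of the periodic operator *)

Lemma mulmx2E (R : pzSemiRingType) (A B : 'M[R]_2) i k :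
  (A *m B) i k = A i 0 * B 0 k + A i 1 * B 1 k.
Proof.
rewrite mxE !big_ord_recl big_ord0 addr0.
by congr (_ + A _ _ * B _ _); apply: val_inj.
Qed.

Section Transfer.
Variables (R : realType) (a b : nat -> R) (E : R).
Local Notation P := (transfer a b E).

Lemma transferS0 n j : P n.+1 0 j =
  (E - b n.+2) / a n.+2 * P n 0 j - a n.+1 / a n.+2 * P n 1 j.
Proof. by rewrite /= mulmx2E !mxE/= mulNr. Qed.

Lemma transferS1 n j : P n.+1 1 j = P n 0 j.
Proof. by rewrite /= mulmx2E !mxE/= mul1r mul0r addr0. Qed.

Hypothesis a_gt0 : forall n, (1 <= n)%N -> 0 < a n.

(** The step matrix at [n] has determinant [a n / a n.+1], and the product telescopes. *)
Lemma transfer_det n :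
  P n 0 0 * P n 1 1 - P n 0 1 * P n 1 0 = a 1%N / a n.+1.
Proof.
elim: n => [|n IHn].
  by rewrite !mxE/= !mulr1 mulr0 subr0 divff// gt_eqF// a_gt0.
have an1 := @a_gt0 n.+1 isT; have an2 := @a_gt0 n.+2 isT.
rewrite !transferS0 !transferS1.
transitivity (a n.+1 / a n.+2 * (P n 0 0 * P n 1 1 - P n 0 1 * P n 1 0)).
  by ring.
by rewrite IHn; field; rewrite !gt_eqF.
Qed.

Variable q : nat.
Hypotheses (aq : forall n, (1 <= n)%N -> a (n + q)%N = a n)
  (bq : forall n, (1 <= n)%N -> b (n + q)%N = b n).

Lemma transferD n : P (n + q)%N = P n *m P q.
Proof.
elim: n => [|n IHn]; first by rewrite add0n mul1mx.
rewrite addSn /= IHn mulmxA; congr (_ *m _ *m _).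
by apply/matrixP => i j; rewrite !mxE -!addSn !aq ?bq.
Qed.

(** Cayley-Hamilton for the monodromy matrix [P q], multiplied on the left by [P n]; its determinant
    is 1 because [a q.+1 = a 1]. *)
Lemma transfer_recurrence n i j :
  P (n + q + q)%N i j = discriminant a b q E * P (n + q)%N i j - P n i j.
Proof.
have detM := transfer_det q.
rewrite -[q.+1]add1n aq// divff ?gt_eqF ?a_gt0// in detM.
rewrite !transferD /discriminant.
have trM : \tr (P q) = P q 0 0 + P q 1 1.
  rewrite /mxtrace !big_ord_recl big_ord0 addr0.
  by congr (_ + P q _ _); apply: val_inj.
rewrite trM; set M := P q in detM *.
rewrite !mulmx2E.
have jE : j = 0 \/ j = 1.
  by case: j => -[|[|//]] h; [left|right]; apply: val_inj.
(* Writing the coefficient 1 of the last term as the determinant turns the claim into a polynomial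
   identity. *)
by case: jE => ->; rewrite -[X in _ = _ - X]mulr1 -detM; ring.
Qed.

Lemma transfer_bounded i j : (0 < q)%N -> `|discriminant a b q E| < 2 ->
  exists B, forall n, `|P n i j| <= B.
Proof.
move=> q0 tE; apply: bounded_residues q0 _ => r.
apply: elliptic_recurrence_bounded tE _ => k.
by rewrite !mulSn ![(q + _)%N]addnC !addnA transfer_recurrence.
Qed.

End Transfer.

(** * Series comparison and slowly varying sequences *)

Lemma nonsummable_ge_harmonic (R : realType) (v : nat -> R) (c : R) (N : nat) :
  0 < c -> (forall n, (N <= n)%N -> c <= n.+1%:R * v n) -> ~ cvgn (series v).
Proof.
move=> c0 cv cvgv; apply: (@dvg_harmonic R).
rewrite -(is_cvg_series_restrict N).
have vn n : (N <= n)%N -> c * harmonic n <= v n.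
  by move=> Nn; rewrite /= ler_pdivrMr// mulrC cv.
rewrite -(is_cvg_series_restrict N) in cvgv.
(* Both sequences are cut to 0 below [N], since the comparison test asks for the inequality at every
   index. *)
pose h n : R := if (n < N)%N then 0 else harmonic n.
pose w n : R := if (n < N)%N then 0 else v n.
have res (z : nat -> R) : (fun n => \sum_(N <= k < n) z k) =
    (fun n => \sum_(N <= k < n) (if (k < N)%N then 0 else z k)).
  apply/funext => n; apply: eq_big_nat => k /andP[Nk _].
  by rewrite ltnNge Nk.
rewrite res is_cvg_series_restrict -/h.
rewrite res is_cvg_series_restrict -/w in cvgv.
apply: (@series_le_cvg _ _ (c^-1 *: w)); last exact: is_cvg_seriesZ.
- by move=> n; rewrite /h; case: ifP => // _; exact: harmonic_ge0.
- move=> n; rewrite /w /=; apply: mulr_ge0; first by rewrite invr_ge0 ltW.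
  case: ltnP => // /vn; apply: le_trans.
  by rewrite mulr_ge0 ?harmonic_ge0// ltW.
- move=> n; have -> : (c^-1 *: w) n = c^-1 * w n by [].
  rewrite /h /w; case: ltnP => [_|/vn]; first by rewrite mulr0.
  by rewrite [_^-1 * _]mulrC ler_pdivlMr// mulrC.
Qed.

(* One step multiplies [g] by at least [(1-e)/(1+e)], whose square is at least
   [n/(n+1)] as soon as [e <= 1/(4(n+1))]. *)
Lemma slow_variation_lower_bound (R : realType) (g e : nat -> R) (N : nat) :
  (forall n, 0 < g n) -> (forall n, 0 <= e n) ->
  (forall n, `|g n.+1 - g n| <= e n * (g n.+1 + g n)) ->
  (forall n, (N <= n)%N -> 4 * n.+1%:R * e n <= 1) ->
  exists2 c, 0 < c & forall n, (N < n)%N -> c <= n%:R * g n ^+ 2.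
Proof.
move=> g0 e0 ge eN; exists (N.+1%:R * g N.+1 ^+ 2).
  by rewrite mulr_gt0// exprn_gt0.
move=> n; elim: n => // n IHn; rewrite ltnS leq_eqVlt => /predU1P[->//|Nn].
apply: (le_trans (IHn Nn)).
have := eN n (ltnW Nn); have := e0 n; have := ge n.
rewrite -[n.+1%:R]natr1; have := g0 n; have := g0 n.+1; have := ler0n R n.
set x := g n; set y := g n.+1; set d := e n; set m := n%:R.
move=> m0 y0 x0; rewrite ler_norml => /andP[h _] d0 dm.
have d1 : d <= 1 by nra.
have xy : (1 - d) * x <= (1 + d) * y by lra.
have xy2 : ((1 - d) * x) ^+ 2 <= ((1 + d) * y) ^+ 2.
  by rewrite ler_pXn2r// nnegrE; nra.
(* Right side minus left side is [1 - 4 * (m + 1) * d + 2 * d + d ^+ 2]. *)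
have dd : m * (1 + d) ^+ 2 <= (m + 1) * (1 - d) ^+ 2 by nra.
have : m * (1 + d) ^+ 2 * x ^+ 2 <= (m + 1) * ((1 + d) * y) ^+ 2.
  apply: (@le_trans _ _ ((m + 1) * ((1 - d) * x) ^+ 2)).
    have -> : (m + 1) * ((1 - d) * x) ^+ 2 = (m + 1) * (1 - d) ^+ 2 * x ^+ 2.
      by ring.
    by rewrite ler_wpM2r// sqr_ge0.
  by rewrite ler_wpM2l//; lra.
have -> : m * (1 + d) ^+ 2 * x ^+ 2 = (1 + d) ^+ 2 * (m * x ^+ 2) by ring.
have -> : (m + 1) * ((1 + d) * y) ^+ 2 = (1 + d) ^+ 2 * ((m + 1) * y ^+ 2).
  by ring.
by rewrite ler_pM2l// exprn_gt0//; lra.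
Qed.

Lemma cvgn_series_shift (R : realType) (v : nat -> R) :
  cvgn (series v) -> cvgn (series (fun n => v n.+1)).
Proof.
move=> vc.
have -> : series (fun n => v n.+1) = (fun n => series v n.+1 - v 0%N).
  by apply/funext => n; rewrite !seriesEnat /= big_nat_recl// addrC addKr.
apply: is_cvgB; last exact: is_cvg_cst.
by apply/cvg_ex; exists (limn (series v)); rewrite (cvg_shiftS (series v)).
Qed.

Lemma cvgn0_norm_bounded (R : realType) (f : nat -> R) :
  (fun n : nat => (1 + n%:R) * f n) @ \oo --> (0 : R) ->
  exists B, forall n, `|f n| <= B.
Proof.
move=> /cvgP /cvg_seq_bounded[M [_ fM]]; exists (`|M| + 1) => n.
have ltM : M < `|M| + 1 by rewrite ltr_pwDr// ler_norm.
apply: le_trans (fM _ ltM n I); rewrite normrM ler_peMl//.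
by rewrite ger0_norm ?lerDl ?addr_ge0.
Qed.

(** * Real solutions of the perturbed equation *)

Section RealSolutions.
Variables (R : realType) (q : nat) (a b a' b' : nat -> R) (E : R).
Hypotheses (q_gt0 : (1 <= q)%N)
  (aq : forall n, (1 <= n)%N -> a (n + q)%N = a n)
  (bq : forall n, (1 <= n)%N -> b (n + q)%N = b n)
  (a_gt0 : forall n, (1 <= n)%N -> 0 < a n)
  (aa'_gt0 : forall n, (1 <= n)%N -> 0 < a n + a' n)
  (a'0 : (fun n : nat => (1 + n%:R) * a' n) @ \oo --> (0 : R))
  (b'0 : (fun n : nat => (1 + n%:R) * b' n) @ \oo --> (0 : R))
  (discE : `|discriminant a b q E| < 2).
Variable u : nat -> R.
Hypothesis uE : forall n,
  (a n.+2 + a' n.+2) * u n.+2 + (a n.+1 + a' n.+1) * u n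
    + (b n.+2 + b' n.+2) * u n.+1 = E * u n.+1.
Local Notation P := (transfer a b E).

(** Both outer coefficients are nonzero, so two consecutive zeros propagate forwards and
    backwards. *)
Lemma jacobi_solution_eq0 n :
  u n = 0 -> u n.+1 = 0 -> forall m, u m = 0.
Proof.
pose Z k := u k = 0 /\ u k.+1 = 0.
have ZS k : Z k <-> Z k.+1.
  split=> -[u0 u1]; split=> //; move/eqP: (uE k); rewrite u0 u1 !mulr0.
    by rewrite !addr0 mulf_eq0 gt_eqF ?aa'_gt0//= => /eqP.
  by rewrite add0r addr0 mulf_eq0 gt_eqF ?aa'_gt0//= => /eqP.
have Z0 k : Z k <-> Z 0%N by elim: k => // k; rewrite (ZS k).
by move=> u0 u1 m; case: (iffRL (Z0 m)) => //; apply: iffLR (Z0 n) _.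
Qed.

(* Coordinate [j] of the variation of parameters: a Wronskian of [u] with the
   unperturbed solution [n |-> P n 1 j], in which only the coefficient of
   [u n.+1] is perturbed. *)
Definition wronskian (j : 'I_2) n : R :=
  (a n.+1 + a' n.+1) * u n.+1 * P n 1 j - a n.+1 * u n * P n 0 j.

(** Eliminating [u n.+2] and [P n.+1] by their recurrences cancels every unperturbed term; each
    remaining one has a factor [a'] or [b']. *)
Lemma wronskianS j n : wronskian j n.+1 - wronskian j n =
  - b' n.+2 * u n.+1 * P n 0 j
  - a' n.+1 * (u n * P n 0 j + u n.+1 * P n 1 j).
Proof.
have an2 := @a_gt0 n.+2 isT.
rewrite /wronskian transferS0 transferS1.
have -> : (a n.+2 + a' n.+2) * u n.+2 = E * u n.+1
  - (a n.+1 + a' n.+1) * u n - (b n.+2 + b' n.+2) * u n.+1.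
  by rewrite -uE; ring.
by field; rewrite gt_eqF.
Qed.

(** Cramer's rule: the two Wronskians are linear in [u n] and [u n.+1], with a determinant given by
    [transfer_det]. *)
Lemma wronskian_solution0 n :
  a 1%N * u n = wronskian 1 n * P n 1 0 - wronskian 0 n * P n 1 1.
Proof.
have an1 := @a_gt0 n.+1 isT.
transitivity (a n.+1 * u n * (P n 0 0 * P n 1 1 - P n 0 1 * P n 1 0)).
  by rewrite transfer_det//; field; rewrite gt_eqF.
by rewrite /wronskian; ring.
Qed.

Lemma wronskian_solution1 n :
  (a n.+1 + a' n.+1) * u n.+1 * (a 1%N / a n.+1) =
  wronskian 1 n * P n 0 0 - wronskian 0 n * P n 0 1.
Proof. by rewrite -(transfer_det b E a_gt0) /wronskian; ring. Qed.

Lemma transfer_uniformly_bounded : exists B, forall n i j, `|P n i j| <= B.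
Proof.
have PB i j := transfer_bounded a_gt0 aq bq i j q_gt0 discE.
have /choice[B BP] : forall ij : 'I_2 * 'I_2,
  exists B, forall n, `|P n ij.1 ij.2| <= B by move=> [i j]; exact: PB.
have B0 ij : 0 <= B ij by apply: le_trans (BP ij 0%N); exact: normr_ge0.
exists (\sum_ij B ij) => n i j.
rewrite (bigD1 (i, j))//=; apply: (le_trans (BP (i, j) n)).
by rewrite lerDl; apply: sumr_ge0.
Qed.

Lemma coefficients_bounded :
  exists D, forall n, (a n.+1 + a' n.+1 <= D) /\ (a n.+1 <= D).
Proof.
have [A aA] : exists A, forall n, `|a n.+1| <= A.
  apply: (bounded_residues q_gt0) => r; exists `|a r.+1| => k.
  suff -> : a (r + k * q).+1 = a r.+1 by [].
  elim: k => [|k IHk]; first by rewrite addn0.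
  by rewrite mulSn addnCA addnC -addSn aq.
have [B aB] := cvgn0_norm_bounded a'0.
exists (A + B) => n.
have := le_trans (ler_norm _) (aB n.+1); have := le_trans (ler_norm _) (aA n).
by have := le_trans (normr_ge0 _) (aB n.+1); split; lra.
Qed.

Lemma real_solution_not_square_summable :
  (exists n, u n != 0) -> ~ cvgn (series (fun n => u n ^+ 2)).
Proof.
move=> [n0 un0] u2.
have [B PB] := transfer_uniformly_bounded.
have [D aD] := coefficients_bounded.
have a1 := @a_gt0 1%N isT.
have B0 : 0 <= B by apply: le_trans (PB 0%N 0 0); exact: normr_ge0.
have D0 : 0 < D by apply: lt_le_trans (aD 0%N).2.
pose g n : R := `|wronskian 0 n| + `|wronskian 1 n|.
(* If both Wronskians vanish at [n], Cramer's rule gives [u n = u n.+1 = 0], hence [u] is zero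
   everywhere. *)
have g0 n : 0 < g n.
  rewrite lt_def addr_ge0// andbT; apply/negP => /eqP gn0.
  have [w00 w10] := (normr_ge0 (wronskian 0 n), normr_ge0 (wronskian 1 n)).
  have w0 : wronskian 0 n = 0 by apply: normr0_eq0; rewrite /g in gn0; lra.
  have w1 : wronskian 1 n = 0 by apply: normr0_eq0; rewrite /g in gn0; lra.
  have u0 : u n = 0.
    apply/eqP; have /eqP := wronskian_solution0 n.
    by rewrite w0 w1 !mul0r subr0 mulf_eq0 gt_eqF.
  have u1 : u n.+1 = 0.
    apply/eqP; have /eqP := wronskian_solution1 n.
    rewrite w0 w1 !mul0r subr0 !mulf_eq0 invr_eq0.
    by rewrite (gt_eqF (aa'_gt0 _))// (gt_eqF a1) (gt_eqF (a_gt0 _))// !orbF.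
  by rewrite (jacobi_solution_eq0 u0 u1) eqxx in un0.
have ug n : `|u n| <= B / a 1%N * g n.
  rewrite mulrAC ler_pdivlMr// -[X in _ * X](gtr0_norm a1) -normrM mulrC.
  rewrite wronskian_solution0 /g; apply: (le_trans (ler_normB _ _)).
  rewrite !normrM mulrDr addrC ![B * _]mulrC.
  by apply: lerD; apply: ler_wpM2l.
(* The 2 counts the Wronskians, [B] bounds the transfer entries in their increments, and [B / a 1]
   converts [u] into [g]. *)
pose K : R := 2 * B * (B / a 1%N).
have K0 : 0 <= K by rewrite /K !mulr_ge0// invr_ge0 ltW.
pose e n : R := K * (`|a' n.+1| + `|b' n.+2|).
have e0 n : 0 <= e n by rewrite mulr_ge0// addr_ge0.
have ws j n : `|wronskian j n.+1 - wronskian j n| <=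
    B * (`|a' n.+1| + `|b' n.+2|) * (`|u n.+1| + `|u n|).
  have hu : `|u n * P n 0 j + u n.+1 * P n 1 j| <= B * (`|u n.+1| + `|u n|).
    rewrite addrC; apply: (le_trans (ler_normD _ _)).
    by rewrite !normrM mulrDr ![B * _]mulrC lerD// ler_wpM2l.
  rewrite wronskianS; apply: (le_trans (ler_normB _ _)).
  have -> : B * (`|a' n.+1| + `|b' n.+2|) * (`|u n.+1| + `|u n|) =
      `|b' n.+2| * (B * (`|u n.+1| + `|u n|))
      + `|a' n.+1| * (B * (`|u n.+1| + `|u n|)) by ring.
  rewrite !normrM normrN -mulrA; apply: lerD; last exact: ler_wpM2l.
  apply: ler_wpM2l => //; rewrite mulrC; apply: ler_pM => //.
  by rewrite lerDl.
have ge n : `|g n.+1 - g n| <= e n * (g n.+1 + g n).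
  have -> : g n.+1 - g n = (`|wronskian 0 n.+1| - `|wronskian 0 n|)
      + (`|wronskian 1 n.+1| - `|wronskian 1 n|) by rewrite /g; ring.
  apply: (le_trans (ler_normD _ _)).
  have w0 := le_trans (ler_dist_dist _ _) (ws 0 n).
  have w1 := le_trans (ler_dist_dist _ _) (ws 1 n).
  apply: (le_trans (lerD w0 w1)).
  have bg : B * (`|a' n.+1| + `|b' n.+2|) * (`|u n.+1| + `|u n|) <=
      B * (`|a' n.+1| + `|b' n.+2|) * (B / a 1%N * g n.+1 + B / a 1%N * g n).
    by rewrite ler_wpM2l ?lerD// mulr_ge0// addr_ge0.
  have -> : e n * (g n.+1 + g n) =
      B * (`|a' n.+1| + `|b' n.+2|)
      * (B / a 1%N * g n.+1 + B / a 1%N * g n) *+ 2.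
    by rewrite /e /K; ring.
  by rewrite mulr2n lerD.
have [N eN] : exists N, forall n, (N <= n)%N -> 4 * n.+1%:R * e n <= 1.
  (* Chosen so that [4 * K * (d + d) = K / (K + 1) <= 1]; the [+ 1] covers [K = 0]. *)
  pose d : R := (8 * (K + 1))^-1.
  have d0 : 0 < d by rewrite invr_gt0; lra.
  have [Na _ aN] := cvgr0_norm_le _ a'0 _ d0.
  have [Nb _ bN] := cvgr0_norm_le _ b'0 _ d0.
  exists (maxn Na Nb) => n; rewrite geq_max => /andP[na nb].
  have ha : `|(1 + n.+1%:R) * a' n.+1| <= d := aN n.+1 (leqW na).
  have hb : `|(1 + n.+2%:R) * b' n.+2| <= d := bN n.+2 (leqW (leqW nb)).
  have n1 m : 0 <= 1 + m%:R :> R by exact: addr_ge0.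
  rewrite normrM (ger0_norm (n1 _)) in ha.
  rewrite normrM (ger0_norm (n1 _)) in hb.
  have {}ha : n.+1%:R * `|a' n.+1| <= d.
    by apply: le_trans ha; rewrite ler_wpM2r// lerDr.
  have {}hb : n.+1%:R * `|b' n.+2| <= d.
    by apply: le_trans hb; rewrite ler_wpM2r// addrC natr1 ler_nat ltnW.
  have -> : 4 * n.+1%:R * e n =
      4 * K * (n.+1%:R * `|a' n.+1| + n.+1%:R * `|b' n.+2|).
    by rewrite /e; ring.
  have : 4 * K * (n.+1%:R * `|a' n.+1| + n.+1%:R * `|b' n.+2|)
      <= 4 * K * (d + d).
    by rewrite ler_wpM2l ?lerD// mulr_ge0.
  move/le_trans; apply.
  have -> : 4 * K * (d + d) = K / (K + 1) by rewrite /d; field; lra.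
  by rewrite ler_pdivrMr; lra.
have [c c0 cg] := slow_variation_lower_bound g0 e0 ge eN.
(* Two Wronskians, each at most [D * B * (|u n.+1| + |u n|)], give [2 * D * B]; squaring with
   [(x + y) ^+ 2 <= 2 * (x ^+ 2 + y ^+ 2)] gives the 8. *)
have gu n : g n ^+ 2 <= 8 * D ^+ 2 * B ^+ 2 * (u n ^+ 2 + u n.+1 ^+ 2).
  have wj j : `|wronskian j n| <= D * B * (`|u n.+1| + `|u n|).
    apply: (le_trans (ler_normB _ _)); rewrite !normrM mulrDr.
    rewrite !(ger0_norm (ltW (a_gt0 _)), ger0_norm (ltW (aa'_gt0 _)))//.
    rewrite ![D * B * _]mulrAC; have [h1 h2] := aD n.
    by apply: lerD; apply: ler_pM;
      rewrite ?mulr_ge0 ?ler_wpM2r// ltW ?a_gt0 ?aa'_gt0.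
  have g2 : g n <= 2 * D * B * (`|u n.+1| + `|u n|).
    by have := wj 0; have := wj 1; rewrite /g; lra.
  apply: (@le_trans _ _ ((2 * D * B * (`|u n.+1| + `|u n|)) ^+ 2)).
    by apply: lerXn2r (g2); rewrite nnegrE ltW// (lt_le_trans (g0 n) g2).
  rewrite -[u n ^+ 2]real_normK ?num_real//.
  rewrite -[u n.+1 ^+ 2]real_normK ?num_real//.
  rewrite -subr_ge0; set x := `|u n|; set y := `|u n.+1|.
  have -> : 8 * D ^+ 2 * B ^+ 2 * (x ^+ 2 + y ^+ 2) - (2 * D * B * (y + x)) ^+ 2
    = (2 * D * B * (x - y)) ^+ 2 by ring.
  exact: sqr_ge0.
pose C := 8 * D ^+ 2 * B ^+ 2.
(* This majorant of [g n ^+ 2] is summable by assumption on [u], yet is at least [c / n.+1] for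
   large [n]. *)
apply: (@nonsummable_ge_harmonic _
  (C *: ((fun n => u n ^+ 2) + (fun n => u n.+1 ^+ 2))) c N.+1 c0).
  move=> n Nn; apply: (le_trans (cg n Nn)).
  apply: ler_pM; rewrite ?ler0n ?sqr_ge0 ?ler_nat//; exact: gu.
apply: is_cvg_seriesZ; apply: is_cvg_seriesD => //.
exact: (@cvgn_series_shift _ (fun n => u n ^+ 2)).
Qed.

End RealSolutions.

(** * Complex solutions through real and imaginary parts *)

Theorem theorem2p7 (R : realType) (q : nat) (a b a' b' : nat -> R) :
  (1 <= q)%N ->
  (forall n, (1 <= n)%N -> a (n + q)%N = a n) ->
  (forall n, (1 <= n)%N -> b (n + q)%N = b n) ->
  (forall n, (1 <= n)%N -> 0 < a n) ->
  (forall n, (1 <= n)%N -> 0 < a n + a' n) ->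
  (fun n : nat => (1 + n%:R) * a' n) @ \oo --> (0 : R) ->
  (fun n : nat => (1 + n%:R) * b' n) @ \oo --> (0 : R) ->
  forall E : R,
    (\bigcup_(cd in spectral_bands a b q) `]cd.1, cd.2[%classic) E ->
    ~ exists u : nat -> R[i],
        [/\ jacobi_solution (fun n => a n + a' n) (fun n => b n + b' n) E u,
            square_summable u
          & exists n, u n <> 0].
Proof.
move=> q0 aq bq a0 aa' a'0 b'0 E [cd [E0 _ cdE]].
rewrite -cdE => /connected_component_sub /= discE [u [uE u2 [n0 un0]]].
(* To be applied to [Re u] and [Im u]: they solve the same equation, as the coefficients and [E] are
   real, and their squares are dominated by the squared modulus of [u]. *)
have real_part (v : nat -> R) :
  (forall n, (a n.+2 + a' n.+2) * v n.+2 + (a n.+1 + a' n.+1) * v n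
    + (b n.+2 + b' n.+2) * v n.+1 = E * v n.+1) ->
  (forall n, v n ^+ 2 <= ComplexField.Normc.normc (u n) ^+ 2) -> v n0 = 0.
  move=> vE vu; apply/eqP/negPn/negP => vn0.
  apply: (real_solution_not_square_summable q0 aq bq a0 aa' a'0 b'0 discE vE).
    by exists n0.
  by apply: series_le_cvg u2 => // n; exact: sqr_ge0.
apply: un0; apply/eqP; rewrite eq_complex.
rewrite (real_part (fun n => complex.Re (u n))).
- rewrite (real_part (fun n => complex.Im (u n))) ?eqxx//= => n.
    have /(congr1 (@complex.Im R)) := uE n.+1 isT.
    rewrite /jacobi /=.
    case: (u n.+2) (u n) (u n.+1) => [x2 y2] [x0 y0] [x1 y1].
    by rewrite /= !mul0r !addr0.
  case: (u n) => x y; rewrite /= sqr_sqrtr ?addr_ge0 ?sqr_ge0//.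
  by rewrite lerDr sqr_ge0.
- move=> n; have /(congr1 (@complex.Re R)) := uE n.+1 isT.
  rewrite /jacobi /=; case: (u n.+2) (u n) (u n.+1) => [x2 y2] [x0 y0] [x1 y1].
  by rewrite /= !mul0r !subr0.
- move=> n; case: (u n) => x y; rewrite /= sqr_sqrtr ?addr_ge0 ?sqr_ge0//.
  by rewrite lerDl sqr_ge0.
Qed.
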